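(* Let $T=\{1324,1342,4123\}$. Then $$F_T(x)=\frac{1-3x+x^2-x^3-(1-x)^3\sqrt{1-4x}}{2x(1-4x+4x^2-x^3)}.$$
   Context: $S_n(T)$ denotes the set of permutations $\pi$ of $[n]=\{1,\dots,n\}$ (one-line notation) that avoid every pattern $\tau\in T$, i.e. no subsequence of $\pi$ is order-isomorphic to $\tau$. $F_T(x)=\sum_{n\ge 0}|S_n(T)|x^n$, a formal power series, with $|S_0(T)|=1$. Here $\sqrt{1-4x}$ is the formal power series with constant term $1$ whose square is $1-4x$. *)

(* Defs.v *)
From HB Require Import structures.
From mathcomp Require Import all_boot all_order all_algebra all_fingroup.
From mathcomp Require Import boolp classical_sets.

Set Implicit Arguments.
Unset Strict Implicit.
Unset Printing Implicit Defensive.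

Import GRing.Theory.
Local Open Scope ring_scope.

Record fps (R : idomainType) := Fps { fcoef : nat -> R }.
Notation "{ 'fps' R }" := (fps R) (at level 0, format "{ 'fps'  R }").

HB.instance Definition _ (R : idomainType) := gen_eqMixin {fps R}.
HB.instance Definition _ (R : idomainType) := gen_choiceMixin {fps R}.

Section FormalPowerSeries.
Variable R : idomainType.
Implicit Types a b c : {fps R}.

Lemma fpsP a b : (forall n, fcoef a n = fcoef b n) -> a = b.
Proof. by case: a b => [u] [v] /= /funext ->. Qed.

Definition fps_zero : {fps R} := Fps (fun=> 0).
Definition fps_opp a := Fps (fun n => - fcoef a n).
Definition fps_add a b := Fps (fun n => fcoef a n + fcoef b n).
Definition fps_one : {fps R} := Fps (fun n => (n == 0)%:R).
Definition fps_mul a b :=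
  Fps (fun n => \sum_(i < n.+1) fcoef a i * fcoef b (n - i)%N).

Fact fps_addA : associative fps_add.
Proof. by move=> a b c; apply: fpsP => n; exact: addrA. Qed.
Fact fps_addC : commutative fps_add.
Proof. by move=> a b; apply: fpsP => n; exact: addrC. Qed.
Fact fps_add0 : left_id fps_zero fps_add.
Proof. by move=> a; apply: fpsP => n; exact: add0r. Qed.
Fact fps_addN : left_inverse fps_zero fps_opp fps_add.
Proof. by move=> a; apply: fpsP => n; exact: addNr. Qed.

HB.instance Definition _ := GRing.isZmodule.Build {fps R}
  fps_addA fps_addC fps_add0 fps_addN.

Let trunc N a : {poly R} := \poly_(i < N.+1) fcoef a i.

Let coef_trunc N a n : (n <= N)%N -> (trunc N a)`_n = fcoef a n.
Proof. by move=> nN; rewrite coef_poly ltnS nN. Qed.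

Let coef_truncM N a b n : (n <= N)%N ->
  fcoef (fps_mul a b) n = (trunc N a * trunc N b)`_n.
Proof.
move=> nN; rewrite coefM; apply: eq_bigr => i _.
rewrite !coef_trunc //; first by rewrite (leq_trans (leq_subr _ _)).
by rewrite (leq_trans _ nN) // -ltnS.
Qed.

Fact fps_mulA : associative fps_mul.
Proof.
move=> a b c; apply: fpsP => n.
rewrite !(@coef_truncM n) //.
have -> : (trunc n a * trunc n (fps_mul b c))`_n
        = (trunc n a * (trunc n b * trunc n c))`_n.
  rewrite !(coefM (trunc n a)); apply: eq_bigr => i _.
  by congr (_ * _); rewrite coef_trunc ?leq_subr // (@coef_truncM n) // leq_subr.
rewrite mulrA !(coefMr _ (trunc n c)); apply: eq_bigr => i _.
by congr (_ * _); rewrite coef_trunc ?leq_subr // (@coef_truncM n) // leq_subr.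
Qed.

Fact fps_mulC : commutative fps_mul.
Proof. by move=> a b; apply: fpsP => n; rewrite !(@coef_truncM n) // mulrC. Qed.

Fact fps_mul1 : left_id fps_one fps_mul.
Proof.
move=> a; apply: fpsP => n /=; rewrite big_ord_recl /= mul1r subn0 big1 ?addr0 //.
by move=> i _; rewrite mul0r.
Qed.

Fact fps_mulDl : left_distributive fps_mul fps_add.
Proof.
move=> a b c; apply: fpsP => n /=; rewrite -big_split.
by apply: eq_bigr => i _; rewrite mulrDl.
Qed.

Fact fps_one_neq0 : fps_one != 0 :> {fps R}.
Proof. by apply/eqP => /(congr1 (fun a => fcoef a 0)) /eqP; rewrite oner_eq0. Qed.

HB.instance Definition _ := GRing.Zmodule_isComNzRing.Build {fps R}
  fps_mulA fps_mulC fps_mul1 fps_mulDl fps_one_neq0.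

Definition fps_unit : pred {fps R} := fun a => `[< exists b, b * a = 1 >].
Definition fps_inv a := if fps_unit a then xget a [set b | b * a = 1]%classic else a.

Fact fps_mulV : {in fps_unit, left_inverse 1 fps_inv *%R}.
Proof.
move=> a ua; rewrite /fps_inv ifT //.
by have /asboolP [b ba] := ua; exact: (@xgetI _ a [set b | b * a = 1]%classic b ba).
Qed.
Fact fps_unitP a b : b * a = 1 -> fps_unit a.
Proof. by move=> ba; apply/asboolP; exists b. Qed.
Fact fps_inv_out : {in [predC fps_unit], fps_inv =1 id}.
Proof. by move=> a ua; rewrite /fps_inv ifN. Qed.

HB.instance Definition _ := GRing.ComNzRing_hasMulInverse.Build {fps R}
  fps_mulV fps_unitP fps_inv_out.

Let valuation a : a != 0 ->
  exists2 m, fcoef a m != 0 & forall i, (i < m)%N -> fcoef a i = 0.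
Proof.
move=> a0.
have ex : exists n, fcoef a n != 0.
  apply: contrapT => h; move/eqP: a0; apply; apply: fpsP => n.
  by apply/eqP; apply: contrapT => /negP hn; apply: h; exists n.
case: (ex_minnP ex) => m am mmin; exists m => // i im.
by apply/eqP/negPn/negP => /mmin; rewrite leqNgt im.
Qed.

Fact fps_mulf_eq0 a b : a * b = 0 -> (a == 0) || (b == 0).
Proof.
move=> ab; apply/norP => -[/valuation [m am ma] /valuation [n bn nb]].
have /eqP : fcoef (a * b) (m + n) = 0 by rewrite ab.
have mlt : (m < (m + n).+1)%N by rewrite ltnS leq_addr.
rewrite /= (bigD1 (Ordinal mlt)) //= addKn big1 ?addr0.
  by rewrite mulf_eq0 (negbTE am) (negbTE bn).
move=> i; rewrite -val_eqE /= neq_ltn => /orP [/ma -> | mi]; first by rewrite mul0r.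
by rewrite nb ?mulr0 // ltn_subLR ?ltn_add2r // -ltnS.
Qed.

HB.instance Definition _ := GRing.ComUnitRing_isIntegral.Build {fps R} fps_mulf_eq0.

Definition fpsX : {fps R} := Fps (fun n => (n == 1)%:R).

End FormalPowerSeries.

(* Meaningful when the constant term of [a] is 1, see [fps_sqrtP] and
   [fps_sqrt_unique]; the junk value is 0. *)
Definition fps_sqrt (a : {fps rat}) : {fps rat} :=
  xget 0 [set s : {fps rat} | fcoef s 0 = 1 /\ s ^+ 2 = a]%classic.

Section FpsSqrt.
Variable a : {fps rat}.
Hypothesis a0 : fcoef a 0 = 1.

Let step (l : seq rat) : rat :=
  if l is [::] then 1 else
  (fcoef a (size l) - \sum_(1 <= i < size l) l`_i * l`_(size l - i)) / 2.
Let prefix n : seq rat := iter n (fun l => rcons l (step l)) [::].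
Let root n : rat := step (prefix n).

Let size_prefix n : size (prefix n) = n.
Proof. by elim: n => //= n IH; rewrite size_rcons IH. Qed.

Let nth_prefix n i : (i < n)%N -> (prefix n)`_i = root i.
Proof.
elim: n => //= n IH; rewrite ltnS leq_eqVlt => /orP [/eqP -> | lt_in].
  by rewrite nth_rcons size_prefix ltnn eqxx.
by rewrite nth_rcons size_prefix lt_in IH.
Qed.

Let rootS n : root n.+1 =
  (fcoef a n.+1 - \sum_(1 <= i < n.+1) root i * root (n.+1 - i)) / 2.
Proof.
rewrite /root /step; have := size_prefix n.+1.
case E : (prefix n.+1) => [//|y l] sz; rewrite sz -E.
congr ((_ - _) / _); apply: eq_big_nat => i /andP [i1 iS].
rewrite !nth_prefix //; case: i i1 {iS} => // i _.
by rewrite ltnS subSS leq_subr.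
Qed.

Lemma fps_sqrt_exists : exists s : {fps rat}, fcoef s 0 = 1 /\ s ^+ 2 = a.
Proof.
exists (Fps root); split=> //; apply: fpsP => -[|n].
  by rewrite /= big_ord1 subn0 a0 mulr1.
rewrite /= -(big_mkord xpredT (fun i => root i * root (n.+1 - i))).
rewrite big_nat_recl // big_nat_recr //= subnn subn0.
have r0 : root 0 = 1 by [].
rewrite r0 mul1r mulr1 addrCA -mulr2n rootS -[_ *+ 2]mulr_natr divfK //.
by rewrite big_add1 /= addrC subrK.
Qed.

Lemma fps_sqrtP : fcoef (fps_sqrt a) 0 = 1 /\ fps_sqrt a ^+ 2 = a.
Proof.
exact: (@xgetPex _ 0 [set s | fcoef s 0 = 1 /\ s ^+ 2 = a]%classic fps_sqrt_exists).
Qed.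

Lemma fps_sqrt_unique s : fcoef s 0 = 1 -> s ^+ 2 = a -> s = fps_sqrt a.
Proof.
have [t0 t2] := fps_sqrtP; move=> s0 s2; apply/eqP.
have: s ^+ 2 == fps_sqrt a ^+ 2 by rewrite s2 t2.
rewrite eqf_sqr => /orP [//|/eqP sN].
by move: s0; rewrite sN /= t0.
Qed.

End FpsSqrt.

Definition one_line n (p : {perm 'I_n}) : seq nat :=
  [seq (p i).+1 | i <- enum 'I_n].

Definition order_isomorphic (s t : seq nat) : bool :=
  (size s == size t) &&
  [forall i : 'I_(size s), forall j : 'I_(size s),
     (nth 0 s i < nth 0 s j)%N == (nth 0 t i < nth 0 t j)%N].

(* The subsequences of a word of length n are its masks by bit-tuples. *)
Definition contains_pattern n (p : {perm 'I_n}) (t : seq nat) : bool :=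
  [exists m : n.-tuple bool, order_isomorphic (mask m (one_line p)) t].

Lemma contains_patternP n (p : {perm 'I_n}) t :
  reflect (exists2 s, subseq s (one_line p) & order_isomorphic s t)
          (contains_pattern p t).
Proof.
have sz : size (one_line p) = n by rewrite size_map size_enum_ord.
apply: (iffP existsP) => [[m ms]|[s /subseqP [m sm ->] ms]].
  by exists (mask m (one_line p)) => //; apply: mask_subseq.
by move/eqP: sm; rewrite sz => sm; exists (Tuple sm).
Qed.

Definition avoiders n (T : seq (seq nat)) : {set {perm 'I_n}} :=
  [set p : {perm 'I_n} | all (fun t => ~~ contains_pattern p t) T].

Definition avoiders_gf (T : seq (seq nat)) : {fps rat} :=
  Fps (fun n => #|avoiders n T|%:R).

(* Main.v *)
(* Build permutations by prepending letters.  A new first letter a is allowed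
   iff the letters above a avoid 213 and 231 and the letters below a avoid 123,
   so the allowed sites form an interval.  Measured from the top it is [b, al];
   with e the distance from the top of the lowest site above which the word is
   decreasing, the triple (al, b, e) evolves autonomously, which gives a
   generating tree.  Nodes
   (e + 1, 0, e) follow the Catalan rule, up to one extra child whose subtree has
   generating function 1 / (1 - 3x + x^2) whatever e is.  With
   C = (1 - sqrt (1 - 4x)) / (2x), the subtrees of these nodes and of the nodes
   (e, 0, e), the root being (0, 0, 0), are affine in C^(e + 1). *)
Require Import Defs.
From mathcomp Require Import all_boot all_order all_algebra all_fingroup.
From mathcomp Require Import zify ring.
Local Open Scope ring_scope.

Set Implicit Arguments.
Unset Strict Implicit.
Unset Printing Implicit Defensive.

Import GRing.Theory.

(** * Pattern avoidance of words, tested at each first letter *)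

Section Words.
Local Open Scope nat_scope.
Implicit Types (s w : seq nat) (a b c d e n al : nat).

Definition decreasing s := pairwise gtn s.

(* A word avoids 213 and 231 iff each letter is the maximum or the minimum of
   the suffix that it starts. *)
Fixpoint avoids213_231 s :=
  if s is x :: s' then
    (all (gtn x) s' || all (ltn x) s') && avoids213_231 s'
  else true.

Fixpoint avoids123 s :=
  if s is x :: s' then decreasing [seq y <- s' | x < y] && avoids123 s'
  else true.

(** Deleting the leading 1 of 1324 and 1342 leaves 213 and 231 above it; deleting the leading 4 of
    4123 leaves 123 below it. *)
Fixpoint avoidsT s :=
  if s is x :: s' then
    [&& avoids213_231 [seq y <- s' | x < y],
        avoids123 [seq y <- s' | y < x] & avoidsT s']
  else true.

Lemma subseq_consE (x y : nat) s t :
  subseq (x :: t) (y :: s) <-> (x = y /\ subseq t s) \/ subseq (x :: t) s.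
Proof.
rewrite /=; case: eqVneq => [->|xy]; last first.
  by split; [right | case=> [[/eqP]|]]; rewrite ?(negbTE xy).
split; first by left.
by case=> [[]//|]; apply/subseq_trans/subseq_cons.
Qed.

Lemma decreasingP s : uniq s ->
  decreasing s <-> (forall x y, subseq [:: x; y] s -> ~ x < y).
Proof.
elim: s => [|z s IH] //= /andP [zs us]; split.
  move=> /andP [/allP zd /(IH us) d] x y /subseq_consE [[-> ys]|]; last exact: d.
  by have := zd y; rewrite -sub1seq => /(_ ys) /=; lia.
move=> d; apply/andP; split; last first.
  by apply/(IH us) => x y xy; apply: d; apply/subseq_consE; right.
apply/allP => y ys /=; have := d z y; rewrite subseq_consE sub1seq.
move=> /(_ (or_introl (conj erefl ys))) zy.
by have: y != z by [apply: contraNneq zs => <-]; lia.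
Qed.

Lemma avoids123P s : uniq s ->
  avoids123 s <-> (forall x y z, subseq [:: x; y; z] s -> ~ x < y < z).
Proof.
elim: s => [|t s IH] //= /andP [ts us]; split.
  move=> /andP [/decreasingP d /(IH us) v] x y z /subseq_consE [[-> ys]|]; last exact: v.
  move=> /andP [ty yz]; apply: (d _ y z _ yz); first exact: filter_uniq.
  by rewrite subseq_filter ys /= ty (ltn_trans ty yz).
move=> d; apply/andP; split; last first.
  by apply/(IH us) => x y z xyz; apply: d; apply/subseq_consE; right.
apply/decreasingP; first exact: filter_uniq.
move=> x y; rewrite subseq_filter /= => /andP [/and3P [tx ty _] xys] xy.
by apply: (d t x y); [apply/subseq_consE; left | rewrite tx].
Qed.

Lemma avoids213_231P s : uniq s ->
  avoids213_231 s <->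
  (forall x y z, subseq [:: x; y; z] s -> ~ (y < x < z) /\ ~ (z < x < y)).
Proof.
elim: s => [|t s IH] //= /andP [ts us]; split.
  move=> /andP [d /(IH us) v] x y z /subseq_consE [[-> yzs]|]; last exact: v.
  have ys : y \in s by apply: (mem_subseq yzs); rewrite !inE eqxx.
  have zs : z \in s by apply: (mem_subseq yzs); rewrite !inE eqxx orbT.
  by case/orP: d => /allP d; have /= := d y ys; have /= := d z zs; lia.
move=> d; apply/andP; split; last first.
  by apply/(IH us) => x y z xyz; apply: d; apply/subseq_consE; right.
have {}d y z : subseq [:: y; z] s -> ~ (y < t < z) /\ ~ (z < t < y).
  by move=> yz; apply: d; apply/subseq_consE; left.
(* The letter [y] right after [t] fixes the side: a later letter on the other side of [t] would
   complete a forbidden triple. *)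
elim: {IH us} s ts d => [//|y s IH]; rewrite inE negb_or => /andP [ty ts] d.
have dy z : z \in s -> ~ (y < t < z) /\ ~ (z < t < y).
  by move=> zs; apply: d; apply/subseq_consE; left; rewrite sub1seq.
have ne z : z \in s -> z != t by move=> zs; apply: contraNneq ts => <-.
case: (ltngtP y t) => yt; last by rewrite yt eqxx in ty.
  by apply/orP; left; rewrite /= yt; apply/allP => z zs /=;
    have := dy z zs; have := ne z zs; lia.
by apply/orP; right; rewrite /= yt; apply/allP => z zs /=;
    have := dy z zs; have := ne z zs; lia.
Qed.

Lemma avoidsTP s : uniq s ->
  avoidsT s <-> (forall t x y z, subseq [:: t; x; y; z] s ->
     [/\ ~ (t < y < x /\ x < z), ~ (t < z < x /\ x < y) & ~ (x < y < z /\ z < t)]).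
Proof.
elim: s => [|v s IH] //= /andP [vs us]; split.
  move=> /and3P [/avoids213_231P d1 /avoids123P d2 /(IH us) d3] t x y z.
  move=> /subseq_consE [[-> xyz]|]; last exact: d3.
  have {}d1 : v < x -> v < y -> v < z -> ~ (y < x < z) /\ ~ (z < x < y).
    by move=> vx vy vz; apply: d1; rewrite ?filter_uniq // subseq_filter /= vx vy vz.
  have {}d2 : x < v -> y < v -> z < v -> ~ (x < y < z).
    by move=> vx vy vz; apply: d2; rewrite ?filter_uniq // subseq_filter /= vx vy vz.
  by split; lia.
move=> d; apply/and3P; split.
- apply/avoids213_231P; first exact: filter_uniq.
  move=> x y z; rewrite subseq_filter /= => /andP [h xyz].
  by have [] := d v x y z (proj2 (subseq_consE _ _ _ _) (or_introl (conj erefl xyz))); lia.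
- apply/avoids123P; first exact: filter_uniq.
  move=> x y z; rewrite subseq_filter /= => /andP [h xyz].
  by have [] := d v x y z (proj2 (subseq_consE _ _ _ _) (or_introl (conj erefl xyz))); lia.
by apply/(IH us) => t x y z xyz; apply: d; apply/subseq_consE; right.
Qed.

(** Quantifiers over ordinals become [all] over [iota], which computes on explicit patterns and
    leaves goals for [lia]. *)
Lemma order_isomorphicE s t : order_isomorphic s t =
  (size s == size t) && all (fun i => all (fun j =>
     (nth 0 s i < nth 0 s j) == (nth 0 t i < nth 0 t j)) (iota 0 (size s))) (iota 0 (size s)).
Proof.
congr (_ && _); apply/forallP/allP => [h i|h i].
  rewrite mem_iota add0n => /= ilt; apply/allP => j; rewrite mem_iota add0n => /= jlt.
  by have /forallP /(_ (Ordinal jlt)) := h (Ordinal ilt).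
by apply/forallP => j; apply: (allP (h i _)); rewrite mem_iota add0n /=.
Qed.

Lemma avoids_T_one_line n (p : {perm 'I_n}) :
  all (fun t => ~~ contains_pattern p t)
    [:: [:: 1; 3; 2; 4]; [:: 1; 3; 4; 2]; [:: 4; 1; 2; 3]] = avoidsT (one_line p).
Proof.
have us : uniq (one_line p).
  by rewrite map_inj_uniq ?enum_uniq // => i j [] /val_inj /perm_inj.
have iso4 s t : order_isomorphic s t -> size t = 4 -> exists a b c d, s = [:: a; b; c; d].
  by move=> /andP [/eqP + _] st; rewrite st; case: s => [|a [|b [|c [|d []]]]] // _; exists a, b, c, d.
apply/idP/idP.
  move=> /= /and4P [/contains_patternP h1 /contains_patternP h2 /contains_patternP h3 _].
  apply/avoidsTP => // t x y z sub; split=> lt.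
  - by apply: h1; exists [:: t; x; y; z] => //; rewrite order_isomorphicE /=; lia.
  - by apply: h2; exists [:: t; x; y; z] => //; rewrite order_isomorphicE /=; lia.
  - by apply: h3; exists [:: t; x; y; z] => //; rewrite order_isomorphicE /=; lia.
move=> /(avoidsTP us) h /=; apply/and4P; split=> //; apply/contains_patternP => -[s sub iso].
all: have [a [b [c [d E]]]] := iso4 _ _ iso erefl.
all: move: iso sub; rewrite E order_isomorphicE /= => iso /h []; lia.
Qed.

(** * Prepending a first letter to a standardized word *)

Definition prepend a w := a :: map (bump a) w.

Definition upper c w := [seq y <- w | c <= y].
Definition lower c w := [seq y <- w | y < c].

Lemma ltn_bump a x y : (bump a x < bump a y) = (x < y).
Proof. by rewrite !ltnNge leq_bump2. Qed.

Lemma decreasing_bump a s : decreasing (map (bump a) s) = decreasing s.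
Proof.
rewrite /decreasing pairwise_map; apply: eq_pairwise => x y /=; exact: ltn_bump.
Qed.

Lemma all_gtn_bump a x s : all (gtn (bump a x)) (map (bump a) s) = all (gtn x) s.
Proof. by rewrite all_map; apply: eq_all => y /=; apply: ltn_bump. Qed.

Lemma all_ltn_bump a x s : all (ltn (bump a x)) (map (bump a) s) = all (ltn x) s.
Proof. by rewrite all_map; apply: eq_all => y /=; apply: ltn_bump. Qed.

Lemma avoids213_231_bump a s : avoids213_231 (map (bump a) s) = avoids213_231 s.
Proof. by elim: s => //= x s ->; rewrite all_gtn_bump all_ltn_bump. Qed.

Lemma filter_bump a (P Q : pred nat) s : (forall y, P (bump a y) = Q y) ->
  [seq y <- map (bump a) s | P y] = map (bump a) [seq y <- s | Q y].
Proof. by move=> PQ; rewrite filter_map; congr map; apply: eq_filter. Qed.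

Lemma avoids123_bump a s : avoids123 (map (bump a) s) = avoids123 s.
Proof.
elim: s => //= x s ->; rewrite (@filter_bump a _ (fun y => x < y)) ?decreasing_bump //.
by move=> y; apply: ltn_bump.
Qed.

Lemma avoidsT_bump a s : avoidsT (map (bump a) s) = avoidsT s.
Proof.
elim: s => //= x s ->; rewrite (@filter_bump a _ (fun y => x < y)); last first.
  by move=> y; apply: ltn_bump.
rewrite (@filter_bump a _ (fun y => y < x)); last by move=> y; apply: ltn_bump.
by rewrite avoids213_231_bump avoids123_bump.
Qed.

Lemma upper_bump a c w : upper c (map (bump a) w) =
  map (bump a) (upper (if a < c then c.-1 else c) w).
Proof. by apply: filter_bump => y; rewrite /bump; case: ifP; lia. Qed.

Lemma lower_bump a c w : lower c (map (bump a) w) =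
  map (bump a) (lower (if a < c then c.-1 else c) w).
Proof. by apply: filter_bump => y; rewrite /bump; case: ifP; lia. Qed.

Lemma avoidsT_prepend a w : avoidsT (prepend a w) =
  [&& avoids213_231 (upper a w), avoids123 (lower a w) & avoidsT w].
Proof.
rewrite /= avoidsT_bump (@filter_bump a _ (fun y => a <= y)); last first.
  by move=> y; rewrite /bump; lia.
rewrite (@filter_bump a _ (fun y => y < a)); last by move=> y; rewrite /bump; lia.
by rewrite avoids213_231_bump avoids123_bump.
Qed.

Definition is_word n w := uniq w /\ (forall y, (y \in w) = (y < n)).

Lemma is_word_prepend n a w : a <= n -> is_word n w -> is_word n.+1 (prepend a w).
Proof.
move=> an [uw mw]; split.
  rewrite /= (map_inj_uniq (can_inj (bumpK a))) uw andbT.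
  by apply/mapP => -[y _]; rewrite /bump; lia.
move=> y; rewrite inE; apply/orP/idP => [[/eqP -> //|/mapP [z]]|yn].
  by rewrite mw /bump; lia.
case: (eqVneq y a) => [|ya]; [by left | right].
by rewrite -(unbumpK ya) mem_map ?mw; [rewrite /unbump; lia | apply/can_inj/bumpK].
Qed.

(** Such a word has at most one letter. *)
Lemma decreasing_const a s : uniq s -> all (pred1 a) s -> decreasing s.
Proof.
move=> + /all_pred1P E; rewrite E => {E}.
by case: (size s) => [|[|k]] //=; rewrite inE eqxx.
Qed.

(* If a + 1 precedes a, then neither is a minimum, so every letter up to
   a + 1 must be the maximum of the suffix that it starts. *)
Lemma decreasing_from_initial a c s : uniq s -> avoids213_231 s ->
  all (leq a) s -> a \in s -> a.+1 \in s -> a.+1 < c ->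
  decreasing (lower c s) -> decreasing s.
Proof.
move=> + + + + + ac; elim: s => // x s IH.
rewrite cons_uniq !inE => /andP [xs us] /= /andP [ex av] /andP [ax as_].
(* If [a] came first, [a.+1] would follow it inside [lower c s], which decreases. *)
have [->|xa] /= := eqVneq x a.
  rewrite (gtn_eqF (ltnSn a)) (ltn_trans (ltnSn a) ac) /= => _ Sas.
  by case/andP => /allP /(_ a.+1); rewrite mem_filter ac Sas => /(_ isT) /=; rewrite ltnNge leqnSn.
move=> ain; have lt_ax : a < x by rewrite ltn_neqAle eq_sym xa.
have gt_s : all (gtn x) s.
  by case/orP: ex => // /allP /(_ _ ain) /=; rewrite ltnNge ltnW.
(* Once [a.+1] is reached as the maximum of its suffix, only [a] can follow it; before that,
   induction applies. *)
rewrite gt_s /=; have [xE _ _|xSa /= Sain d] := eqVneq x a.+1.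
  apply: (@decreasing_const a) => //; apply/allP => y ys /=.
  by rewrite eqn_leq (allP as_) // andbT -ltnS -xE; exact: (allP gt_s).
by apply: IH => //; move: d; case: ifP => // _ /andP [].
Qed.

(** If [a.+1 < c], both [a] and [a.+1] occur below [c] and [decreasing_from_initial] applies;
    otherwise at most the letter [a] remains. *)
Lemma decreasing_between n a c w : is_word n w -> a <= c <= n ->
  avoids213_231 (upper a w) ->
  decreasing (lower c (upper a w)) = (c <= a.+1) || decreasing (upper a w).
Proof.
move=> [uw mw] /andP [ac cn] av.
have uu : uniq (upper a w) by apply: filter_uniq.
apply/idP/orP => [d|[ca|]]; last exact: pairwise_filter.
  case: (leqP c a.+1) => ca; [by left | right].
  apply: (decreasing_from_initial uu av _ _ _ ca d); first exact: filter_all.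
    by rewrite mem_filter mw; lia.
  by rewrite mem_filter mw; lia.
apply: (@decreasing_const a); first exact: filter_uniq.
by apply/allP => y; rewrite !mem_filter /=; lia.
Qed.

(** * Effect of a new first letter on the conditions at each site *)

Section PrependSites.
Variables (n a c : nat) (w : seq nat).
Hypotheses (ww : is_word n w) (an : a <= n).

Let mw y : (y \in w) = (y < n). Proof. by case: ww. Qed.

Lemma upper_prepend : upper c (prepend a w) =
  if a < c then map (bump a) (upper c.-1 w) else a :: map (bump a) (upper c w).
Proof.
by rewrite {1}/upper /= -/(upper _ _) upper_bump; case: ltnP.
Qed.

Lemma lower_prepend : lower c (prepend a w) =
  if a < c then a :: map (bump a) (lower c.-1 w) else map (bump a) (lower c w).
Proof. by rewrite {1}/lower /= -/(lower _ _) lower_bump; case: ltnP. Qed.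

(** If [a < n], the letter [a] of [w] is bumped to [a.+1], above the new first letter. Dually, in
    [all_ltn_upper] a letter [c < a] stays below it. *)
Lemma all_gtn_upper : c <= a ->
  all (gtn a) (map (bump a) (upper c w)) = (a == n).
Proof.
move=> ca; apply/allP/eqP => [h|-> y /mapP [z]]; last first.
  by rewrite mem_filter mw /bump => /andP [_ zn] -> /=; lia.
apply/eqP; rewrite eqn_leq an /= leqNgt; apply/negP => lt_an.
have := h (bump a a); rewrite map_f; last by rewrite mem_filter mw ca.
by move=> /(_ isT) /=; rewrite /bump; lia.
Qed.

Lemma all_ltn_upper : c <= a ->
  all (ltn a) (map (bump a) (upper c w)) = (a == c).
Proof.
move=> ca; apply/allP/eqP => [h|-> y /mapP [z]]; last first.
  by rewrite mem_filter mw /bump => /andP [? zn] -> /=; lia.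
apply/eqP; rewrite eqn_leq ca andbT leqNgt; apply/negP => lt_ca.
have := h (bump a c); rewrite map_f; last by rewrite mem_filter mw; lia.
by move=> /(_ isT) /=; rewrite /bump; lia.
Qed.

Lemma avoids213_231_prepend : avoids213_231 (upper c (prepend a w)) =
  if a < c then avoids213_231 (upper c.-1 w)
  else ((a == n) || (a == c)) && avoids213_231 (upper c w).
Proof.
rewrite upper_prepend; case: ltnP => [_|ca] /=; rewrite avoids213_231_bump //.
by rewrite all_gtn_upper // all_ltn_upper.
Qed.

Lemma decreasing_prepend : decreasing (upper c (prepend a w)) =
  if a < c then decreasing (upper c.-1 w)
  else (a == n) && decreasing (upper c w).
Proof.
rewrite upper_prepend; case: ltnP => [_|ca]; first by rewrite decreasing_bump.
by rewrite /= all_gtn_upper // -/(decreasing _) decreasing_bump.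
Qed.

(** A 123 that starts at the new letter needs an ascent among the letters of [w] from [a] up to
    [c.-1], excluded; [decreasing_between] decides whether there is one. *)
Lemma avoids123_prepend : c <= n.+1 -> avoids213_231 (upper a w) ->
  avoids123 (lower c (prepend a w)) =
  if a < c
  then ((c <= a.+2) || decreasing (upper a w)) && avoids123 (lower c.-1 w)
  else avoids123 (lower c w).
Proof.
move=> cn av; rewrite lower_prepend; case: ltnP => [ac|ca] /=; rewrite avoids123_bump //.
congr (_ && _); rewrite (@filter_bump a _ (leq a)); last first.
  by move=> y; rewrite /bump; lia.
rewrite decreasing_bump.
have -> : [seq y <- lower c.-1 w | a <= y] = lower c.-1 (upper a w).
  by rewrite /lower /upper -!filter_predI; apply: eq_filter => y; apply: andbC.
rewrite (@decreasing_between n) //; last by lia.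
by congr (_ || _); lia.
Qed.

End PrependSites.

(* A new first letter goes into one of the sites 0, ..., n of the word; the
   sites are counted from the top, site c being at distance n - c. *)
Definition sites n w al b e := al <= n /\
  forall c, c <= n -> [/\ avoids213_231 (upper c w) = (n <= c + al),
                          avoids123 (lower c w) = (c + b <= n)
                        & decreasing (upper c w) = (n <= c + e)].

(** [d] is the distance of the chosen site from the top; [d = 0] is admissible only if [b = 0]. A
    letter other than the new maximum makes the site just below it the lowest one left. If [e < d],
    there is an ascent above it, and sites at distance less than [d.-1] would leave a 123 below
    them. For nonzero [d] the last entry is the minimum of [d] and [e]. *)
Definition child al b e d : nat * nat * nat :=
  if d == 0 then (al.+1, 0, e.+1)
  else if e < d then (d.+1, maxn b d.-1, e) else (d.+1, b, d).

Lemma sites_child n w al b e d : is_word n w -> sites n w al b e ->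
  b <= d <= al ->
  let: (al', b', e') := child al b e d in
  sites n.+1 (prepend (n - d) w) al' b' e'.
Proof.
move=> ww [aln st] /andP [bd dal].
have an : n - d <= n := leq_subr _ _.
have [avU _ dU] := st _ an.
have {}avU : avoids213_231 (upper (n - d) w) by rewrite avU; lia.
have step c : c <= n.+1 ->
  [/\ avoids213_231 (upper c (prepend (n - d) w)) =
        if n - d < c then n <= c.-1 + al
        else ((n - d == n) || (n - d == c)) && (n <= c + al),
      avoids123 (lower c (prepend (n - d) w)) =
        if n - d < c
        then ((c <= (n - d).+2) || (n <= n - d + e)) && (c.-1 + b <= n)
        else c + b <= n
    & decreasing (upper c (prepend (n - d) w)) =
        if n - d < c then n <= c.-1 + e else (n - d == n) && (n <= c + e)].
  move=> cn.
  rewrite (@avoids213_231_prepend n) // (@decreasing_prepend n) //.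
  rewrite (@avoids123_prepend n) // dU.
  have c1 : n - d < c -> c.-1 <= n by lia.
  case: ltnP => [/c1 {}c1|cd].
    by have [-> -> _] := st _ c1; have [_ _ ->] := st _ c1.
  have {}c1 : c <= n := leq_trans cd an.
  by have [-> -> ->] := st _ c1.
rewrite /child; case: eqP => [d0|d0]; last case: ltnP => ed.
all: split; first by lia.
all: move=> c cn; have [-> -> ->] := step c cn; split; case: ltnP; lia.
Qed.

(** * Counting avoiders through the generating tree *)

Fixpoint descendants k n w : nat :=
  if k is k'.+1 then
    \sum_(a < n.+1 | avoidsT (prepend a w)) descendants k' n.+1 (prepend a w)
  else 1.

Fixpoint tree_count k al b e : nat :=
  if k is k'.+1 then
    \sum_(b <= d < al.+1)
      let: (al', b', e') := child al b e d in tree_count k' al' b' e'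
  else 1.

Lemma descendants_tree_count k n w al b e : is_word n w -> avoidsT w ->
  sites n w al b e -> descendants k n w = tree_count k al b e.
Proof.
elim: k n w al b e => //= k IH n w al b e ww av st; have [aln stc] := st.
(* [rev_ord] turns the letter [a] into its distance [d] from the top. *)
rewrite (reindex_inj rev_ord_inj) /= big_geq_mkord.
rewrite (big_ord_widen_cond n.+1 (fun d => b <= d) (fun d =>
  let: (al', b', e') := child al b e d in tree_count k al' b' e')) //.
have av_prepend (d : 'I_n.+1) :
    avoidsT (prepend (n.+1 - d.+1) w) = (b <= d) && (d < al.+1).
  have d_n : d <= n by rewrite -ltnS.
  have [eU eV _] := stc (n.+1 - d.+1) (leq_subr _ _).
  by rewrite avoidsT_prepend eU eV av; lia.
apply: eq_big => [d|d avd]; first exact: av_prepend.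
have bd : b <= d < al.+1 by rewrite -av_prepend.
have := sites_child ww st bd.
rewrite subSS; case: (child _ _ _ _) => [[al' b'] e']; apply: IH.
  exact/is_word_prepend/ww/leq_subr.
by rewrite -subSS.
Qed.

Definition word n (p : {perm 'I_n}) : seq nat := [seq val (p i) | i <- enum 'I_n].

(** [one_line] is the zero-based [word] with every letter raised by one, which is [bump 0]. *)
Lemma avoidsT_one_line n (p : {perm 'I_n}) : avoidsT (one_line p) = avoidsT (word p).
Proof. by rewrite -(avoidsT_bump 0 (word p)) -map_comp. Qed.

Lemma word0 (p : {perm 'I_0}) : word p = [::].
Proof. by apply: size0nil; rewrite size_map size_enum_ord. Qed.

Lemma word_lift_perm n (a : 'I_n.+1) (p : {perm 'I_n}) :
  word (lift_perm ord0 a p) = prepend a (word p).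
Proof.
rewrite /word enum_ordSl /= lift_perm_id /prepend -2!map_comp; congr cons.
by apply: eq_map => i /=; rewrite lift_perm_lift.
Qed.

(** A permutation is determined by its first value and the standardized rest; both sides have [n.+1]
    factorial elements, so injectivity suffices. *)
Lemma lift_perm0_bij n : bijective
  (fun pa : {perm 'I_n} * 'I_n.+1 => lift_perm ord0 pa.2 pa.1).
Proof.
apply: inj_card_bij => [[p a] [q b] /= eq_pq|]; last first.
  by rewrite card_prod !card_Sn card_ord mulnC factS.
have eq_ab : a = b by rewrite -(lift_perm_id ord0 a p) eq_pq lift_perm_id.
rewrite -{}eq_ab in eq_pq *; congr (_, _); apply/permP => i.
by apply: (@lift_inj _ a); rewrite -!(lift_perm_lift ord0) eq_pq.
Qed.

(** Removing the first letter of an avoider leaves an avoider, so no avoider of length [n.+1] is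
    missed. *)
Lemma sum_descendants n k :
  \sum_(p : {perm 'I_n} | avoidsT (word p)) descendants k.+1 n (word p) =
  \sum_(p : {perm 'I_n.+1} | avoidsT (word p)) descendants k n.+1 (word p).
Proof.
rewrite [RHS](reindex _ (onW_bij _ (@lift_perm0_bij n))) /= pair_big_dep /=.
apply: eq_big => [[p a]|[p a] _] /=; rewrite word_lift_perm //.
rewrite -[X in _ && X]/(avoidsT (prepend a (word p))) avoidsT_prepend.
by case: (avoidsT (word p)); rewrite /= ?andbT ?andbF.
Qed.

Lemma card_avoiders n :
  #|avoiders n [:: [:: 1; 3; 2; 4]; [:: 1; 3; 4; 2]; [:: 4; 1; 2; 3]]| =
  tree_count n 0 0 0.
Proof.
have ww : is_word 0 [::] by split.
have st : sites 0 [::] 0 0 0 by split=> // -[|c].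
rewrite -(descendants_tree_count n ww) //.
have -> : #|avoiders n [:: [:: 1; 3; 2; 4]; [:: 1; 3; 4; 2]; [:: 4; 1; 2; 3]]| =
    \sum_(p : {perm 'I_n} | avoidsT (word p)) descendants 0 n (word p).
  rewrite /= sum1dep_card; apply: eq_card => p.
  by rewrite !inE avoids_T_one_line avoidsT_one_line.
(* Depth in the tree is traded for length, one letter at a time; at [m = 0] only the empty word is
   left to start from. *)
suff shift k m : \sum_(p : {perm 'I_m} | avoidsT (word p)) descendants k m (word p) =
    \sum_(p : {perm 'I_(k + m)} | avoidsT (word p)) descendants 0 (k + m) (word p).
  have /esym := shift n 0; rewrite addn0 => ->.
  rewrite (big_pred1 (1%g : {perm 'I_0})) => [|p]; last first.
    have -> : p = 1%g by apply/permP => -[].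
    by rewrite word0 /= eqxx.
  by rewrite word0.
elim: k m => [//|k IH] m; rewrite sum_descendants IH.
by rewrite addnS.
Qed.

(* Once b > 0 the new maximum is never available again and the counts no longer
   depend on the position of the active sites. *)
Lemma tree_count_far_step k e t : 0 < e <= t ->
  tree_count k.+1 t.+2 t e =
    tree_count k t.+1 t e + (tree_count k t.+2 t e + tree_count k t.+3 t.+1 e) /\
  tree_count k.+1 t.+1 t e = tree_count k t.+1 t e + tree_count k t.+2 t e.
Proof.
move=> et.
have c0 : child t.+2 t e t = (t.+1, t, e).
  by rewrite /child; case: eqP => [|_]; [lia | case: ltnP => te; congr (_, _, _); lia].
have c0' : child t.+1 t e t = (t.+1, t, e).
  by rewrite /child; case: eqP => [|_]; [lia | case: ltnP => te; congr (_, _, _); lia].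
have c1 al : child al t e t.+1 = (t.+2, t, e).
  by rewrite /child /=; case: ltnP => te; [congr (_, _, _) |]; lia.
have c2 : child t.+2 t e t.+2 = (t.+3, t.+1, e).
  by rewrite /child /=; case: ltnP => te; [congr (_, _, _) |]; lia.
split=> /=.
  by rewrite 3?big_ltn ?big_geq ?c0 ?c1 ?c2 ?addn0 //; lia.
by rewrite 2?big_ltn ?big_geq ?c0' ?c1 ?addn0 //; lia.
Qed.

Lemma tree_count_far k e t : 0 < e <= t ->
  tree_count k t.+2 t e = tree_count k 3 1 1 /\
  tree_count k t.+1 t e = tree_count k 2 1 1.
Proof.
elim: k e t => [//|k IH] e t et.
have [-> ->] := tree_count_far_step k et.
have [-> ->] := @tree_count_far_step k 1 1 isT.
(* The child [(t.+3, t.+1, e)] is of the first kind again, with [t.+1] for [t]. *)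
have [-> ->] := IH e t et; have [|-> _] := IH e t.+1; first by lia.
by have [-> _] := IH 1 2 isT.
Qed.

(** In the tree these nodes are the decreasing words, reached from the root by new maxima only. No
    site has [e < d]. *)
Lemma tree_count_rising_step k e : tree_count k.+1 e 0 e =
  tree_count k e.+1 0 e.+1 + \sum_(i < e) tree_count k i.+2 0 i.+1.
Proof.
rewrite /= big_nat_recl // [child _ _ _ 0]/=; congr (_ + _).
rewrite big_mkord; apply: eq_bigr => i _.
by rewrite /child /= ltnNge ltn_ord.
Qed.

(** The sites up to [e.+1] give the Catalan children, the new maximum supplying the last term of the
    sum. The lowest site [e.+2] gives the extra child, covered by [tree_count_far]. *)
Lemma tree_count_catalan_step k e : tree_count k.+1 e.+2 0 e.+1 =
  \sum_(i < e.+2) tree_count k i.+2 0 i.+1 + tree_count k 3 1 1.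
Proof.
rewrite /= big_nat_recl // [child _ _ _ 0]/= big_mkord !big_ord_recr /=.
have -> : child e.+2 0 e.+1 e.+2 = (e.+3, e.+1, e.+1).
  by rewrite /child /= ltnSn max0n.
have [|-> _] := @tree_count_far k e.+1 e.+1; first by lia.
have -> : child e.+2 0 e.+1 e.+1 = (e.+2, 0, e.+1) by rewrite /child /= ltnn.
rewrite addnA; congr (_ + _); rewrite addnC; congr (_ + _ + _).
apply: eq_bigr => i _; rewrite /child /=.
by rewrite ltnNge ltnS (ltnW (ltn_ord i)).
Qed.

End Words.

(** * Functional equations for the generating functions of subtrees *)

Section GeneratingFunctions.
Local Notation x := (fpsX rat).

Lemma fcoef_Xmul0 (a : {fps rat}) : fcoef (x * a) 0 = 0.
Proof. by rewrite /= big_ord1 mul0r. Qed.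

Lemma fcoef_XmulS (a : {fps rat}) n : fcoef (x * a) n.+1 = fcoef a n.
Proof.
rewrite /= big_ord_recl mul0r add0r big_ord_recl /= mul1r subSS subn0.
by rewrite big1 ?addr0 // => i _; rewrite mul0r.
Qed.

Lemma fcoefD (a b : {fps rat}) n : fcoef (a + b) n = fcoef a n + fcoef b n.
Proof. by []. Qed.

Lemma fcoef_sum m (F : nat -> {fps rat}) n :
  fcoef (\sum_(i < m) F i) n = \sum_(i < m) fcoef (F i) n.
Proof. by elim: m => [|m IH]; rewrite ?big_ord0 // !big_ord_recr /= IH. Qed.

Definition tree_gf al b e : {fps rat} := Fps (fun k => (tree_count k al b e)%:R).

Lemma fcoef_tree_gf al b e k : fcoef (tree_gf al b e) k = (tree_count k al b e)%:R.
Proof. by []. Qed.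

Lemma tree_gf_far : (1 - 3 * x + x ^+ 2) * tree_gf 3 1 1 = 1.
Proof.
set P := tree_gf 3 1 1; set Q := tree_gf 2 1 1.
have PE : P - x * (Q + (P + P)) = 1.
  apply: (canLR (addrK _)); apply: fpsP => -[|k]; rewrite fcoefD ?fcoef_Xmul0 ?addr0 //.
  rewrite fcoef_XmulS add0r !fcoefD !fcoef_tree_gf.
  have [-> _] := @tree_count_far_step k 1 1 isT.
  by have [-> _] := @tree_count_far k 1 2 isT; rewrite !natrD.
have QE : Q - x * (Q + P) = 1.
  apply: (canLR (addrK _)); apply: fpsP => -[|k]; rewrite fcoefD ?fcoef_Xmul0 ?addr0 //.
  rewrite fcoef_XmulS add0r !fcoefD !fcoef_tree_gf.
  by have [_ ->] := @tree_count_far_step k 1 1 isT; rewrite !natrD.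
(* The weights [1 - x] and [x] eliminate [Q] from the two linear equations. *)
have -> : (1 - 3 * x + x ^+ 2) * P =
  (1 - x) * (P - x * (Q + (P + P))) + x * (Q - x * (Q + P)) by ring.
rewrite PE QE; ring.
Qed.

Lemma tree_gf_rising e : tree_gf e 0 e =
  1 + x * (tree_gf e.+1 0 e.+1 + \sum_(i < e) tree_gf i.+2 0 i.+1).
Proof.
apply: fpsP => -[|k]; rewrite fcoefD ?fcoef_Xmul0 ?addr0 // fcoef_XmulS add0r fcoefD.
rewrite (@fcoef_sum _ (fun i => tree_gf i.+2 0 i.+1)).
by rewrite !fcoef_tree_gf tree_count_rising_step natrD natr_sum.
Qed.

Lemma tree_gf_catalan e : tree_gf e.+2 0 e.+1 =
  1 + x * (\sum_(i < e.+2) tree_gf i.+2 0 i.+1 + tree_gf 3 1 1).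
Proof.
apply: fpsP => -[|k]; rewrite fcoefD ?fcoef_Xmul0 ?addr0 // fcoef_XmulS add0r fcoefD.
rewrite (@fcoef_sum _ (fun i => tree_gf i.+2 0 i.+1)).
by rewrite !fcoef_tree_gf tree_count_catalan_step natrD natr_sum.
Qed.

(** The factor [x] makes each coefficient depend on those one degree lower. Applied to the
    difference between a series and its proposed closed form, this gives uniqueness. *)
Lemma fps_eq0_contraction (d : nat -> {fps rat}) (r : nat -> seq nat) :
  (forall e, d e = x * (\sum_(i <- r e) d i)) -> forall e, d e = 0.
Proof.
move=> dE e; apply: fpsP => k /=; elim: k e => [|k IH] e; rewrite dE.
  exact: fcoef_Xmul0.
rewrite fcoef_XmulS.
apply: (big_ind (fun a => fcoef a k = 0)) => // a b a0 b0.
by rewrite fcoefD a0 b0 addr0.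
Qed.

(** * Closed forms in the Catalan series *)

Section ClosedForm.
Variable C : {fps rat}.
Hypothesis C_eq : x * C ^+ 2 = C - 1.

Let xCS m : x * C ^+ m.+2 = C ^+ m.+1 - C ^+ m.
Proof. by rewrite -addn2 exprD mulrCA C_eq exprSr; ring. Qed.

(** By [xCS] the sum telescopes. *)
Lemma sum_catalan_powers m : x * (\sum_(0 <= i < m) C ^+ i.+2) = C ^+ m - 1.
Proof.
elim: m => [|m IH]; first by rewrite big_geq // mulr0 expr0 subrr.
by rewrite big_nat_recr //= mulrDr IH xCS; ring.
Qed.

(** Both sides satisfy the same recursion: [tree_gf_far] turns the extra child into the term [x],
    and [D + x = (1 - x) ^+ 2]. *)
Lemma tree_gf_catalan_closed e :
  (1 - 3 * x + x ^+ 2) * tree_gf e.+2 0 e.+1 = (1 - x) ^+ 2 * C ^+ e.+2.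
Proof.
set D := 1 - 3 * x + x ^+ 2; apply/eqP; rewrite -subr_eq0; apply/eqP; move: e.
apply: (fps_eq0_contraction (r := fun e => index_iota 0 e.+2)) => e.
rewrite sumrB -2!mulr_sumr mulrBr [x * (_ ^+ 2 * _)]mulrCA sum_catalan_powers.
rewrite tree_gf_catalan -(big_mkord xpredT (fun i => tree_gf i.+2 0 i.+1)).
rewrite mulrDr mulr1 mulrCA mulrDr [D * tree_gf _ _ _]tree_gf_far /D; ring.
Qed.

(** With [tree_gf_catalan_closed] substituted, the recursion refers only to [e.+1]. The term [- x]
    solves [p = x * p - x * (1 - x)], where [- x * (1 - x)] is the excess of [(1 - x) * D] over
    [(1 - x) ^+ 3]. *)
Lemma tree_gf_rising_closed e :
  (1 - x) * (1 - 3 * x + x ^+ 2) * tree_gf e 0 e = (1 - x) ^+ 3 * C ^+ e.+1 - x.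
Proof.
set D := 1 - 3 * x + x ^+ 2; apply/eqP; rewrite -subr_eq0; apply/eqP; move: e.
apply: (fps_eq0_contraction (r := fun e => [:: e.+1])) => e.
rewrite big_seq1 [in LHS]tree_gf_rising.
set H := tree_gf e.+1 0 e.+1; set G := \sum_(i < e) _.
have DG : D * (x * G) = (1 - x) ^+ 2 * (C ^+ e - 1).
  rewrite -sum_catalan_powers big_mkord mulrCA [RHS]mulrCA; congr (_ * _).
  by rewrite /G mulr_sumr [RHS]mulr_sumr; apply: eq_bigr => i _; apply: tree_gf_catalan_closed.
have -> : (1 - x) * D * (1 + x * (H + G)) =
  (1 - x) * D + x * ((1 - x) * D * H) + (1 - x) * (D * (x * G)) by ring.
have -> : x * ((1 - x) * D * H - ((1 - x) ^+ 3 * C ^+ e.+2 - x)) =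
  x * ((1 - x) * D * H) - (1 - x) ^+ 3 * (x * C ^+ e.+2) + x ^+ 2 by ring.
rewrite DG xCS /D; ring.
Qed.

End ClosedForm.

End GeneratingFunctions.

Theorem theorem17 :
  let T := [:: [:: 1; 3; 2; 4]; [:: 1; 3; 4; 2]; [:: 4; 1; 2; 3]]%N in
  let x : {fps rat} := fpsX rat in
  tofrac (avoiders_gf T) =
    tofrac (1 - 3 * x + x ^+ 2 - x ^+ 3
              - (1 - x) ^+ 3 * fps_sqrt (1 - 4 * x))
    / tofrac (2 * x * (1 - 4 * x + 4 * x ^+ 2 - x ^+ 3))
    :> {fraction {fps rat}}.
Proof.
move=> T x.
have const_neq0 (a : {fps rat}) : 1 + x * a != 0.
  apply/eqP => /(congr1 (fun b => fcoef b 0)).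
  by rewrite fcoefD fcoef_Xmul0 addr0 => /eqP; rewrite oner_eq0.
have x_neq0 : x != 0.
  by apply/eqP => /(congr1 (fun b => fcoef b 1)) /eqP; rewrite oner_eq0.
have two_neq0 : 2 != 0 :> {fps rat}.
  by apply/eqP => /(congr1 (fun b => fcoef b 0)) /eqP.
have [S0 S2] : fcoef (fps_sqrt (1 - 4 * x)) 0 = 1 /\
    fps_sqrt (1 - 4 * x) ^+ 2 = 1 - 4 * x.
  apply: fps_sqrtP; have -> : 1 - 4 * x = 1 + x * - 4 by ring.
  by rewrite fcoefD fcoef_Xmul0 addr0.
set S := fps_sqrt (1 - 4 * x) in S0 S2 *.
(* This is [(1 - S) / (2 * x)] without division by [x]: the constant term cancels and the index
   shifts. *)
pose C : {fps rat} := Fps (fun n => - fcoef S n.+1 / 2).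
have CE : 2 * (x * C) = 1 - S.
  apply: fpsP => n; rewrite mulr_natl mulr2n fcoefD.
  case: n => [|n]; first by rewrite fcoef_Xmul0 /= S0 subrr.
  by rewrite fcoef_XmulS /= add0r -mulr2n -[_ *+ 2]mulr_natr divfK.
have C_eq : x * C ^+ 2 = C - 1.
  apply/eqP; rewrite -subr_eq0; apply/eqP.
  (* Multiplying by [4 * x] completes the square. *)
  apply: (mulfI (mulf_neq0 (mulf_neq0 two_neq0 two_neq0) x_neq0)); rewrite mulr0.
  have -> : 2 * 2 * x * (x * C ^+ 2 - (C - 1)) =
    (1 - 2 * (x * C)) ^+ 2 - (1 - 4 * x) by ring.
  by rewrite CE subKr S2 subrr.
have -> : avoiders_gf T = tree_gf 0 0 0.
  by apply: fpsP => n; rewrite /= card_avoiders.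
have den_neq0 : 2 * x * (1 - 4 * x + 4 * x ^+ 2 - x ^+ 3) != 0.
  apply: mulf_neq0; first exact: mulf_neq0.
  have -> : 1 - 4 * x + 4 * x ^+ 2 - x ^+ 3 = 1 + x * (- 4 + 4 * x - x ^+ 2) by ring.
  exact: const_neq0.
apply: (canRL (mulfK _)); first by rewrite tofrac_eq0.
rewrite -rmorphM; congr tofrac.
(* The cubic factors as [(1 - x) * (1 - 3 * x + x ^+ 2)], the multiplier in [tree_gf_rising_closed],
   which is used at the root [e = 0]. *)
have -> : tree_gf 0 0 0 * (2 * x * (1 - 4 * x + 4 * x ^+ 2 - x ^+ 3)) =
  2 * x * ((1 - x) * (1 - 3 * x + x ^+ 2) * tree_gf 0 0 0) by ring.
rewrite (tree_gf_rising_closed C_eq) expr1.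
have -> : 2 * x * ((1 - x) ^+ 3 * C - x) =
  (1 - x) ^+ 3 * (2 * (x * C)) - 2 * x ^+ 2 by ring.
rewrite CE; ring.
Qed.
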